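(* Let $\mathcal{L} = (G, a_0, I, \theta)$ be a ladget. Then $a_0$ and $\theta$ are not adjacent in $G$.
   Context: A ladget is a tuple $\mathcal{L}=(G,a_0,I,\theta)$ where $G=(V,E)$ is a finite simple graph, $a_0\in V$ is the anchor vertex, $I=(i_1,\dots,i_n)$ with $n\ge 1$ is an ordered tuple of distinct input vertices, and $\theta\in V$ is the output vertex, with $a_0$, the inputs and $\theta$ pairwise distinct. A valid 3-coloring is a proper coloring $c:V\to\{0,1,2\}$ (adjacent vertices get distinct colors) with $c(a_0)=0$. A vertex has Boolean value $0$ if its color is $0$ and Boolean value $1$ if its color is in $\{1,2\}$. $\mathcal{L}$ is required to implement a Boolean function $\varphi:\{0,1\}^n\to\{0,1\}$ that depends on every input (i.e. for each input coordinate, changing it can change the value of $\varphi$), meaning: (Universality) every assignment of colors from $\{0,1,2\}$ to the input vertices extends to a valid 3-coloring; (Consistency) in every valid 3-coloring, the Boolean value of $\theta$ equals $\varphi$ applied to the Boolean values of $i_1,\dots,i_n$. *)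

(* Defs.v *)
From mathcomp Require Import all_boot.

Set Implicit Arguments.
Unset Strict Implicit.
Unset Printing Implicit Defensive.

Record sgraph := SGraph {
  vertex :> finType;
  adj : rel vertex;
  adj_sym : symmetric adj;
  adj_irrefl : irreflexive adj
}.

(* The tuple (G, a_0, I, theta). That it implements a Boolean function is the
   separate predicate [implements]. *)
Record ladget := Ladget {
  graph : sgraph;
  arity : nat;
  anchor : graph;
  inputs : arity.-tuple graph;
  output : graph;
  arity_gt0 : 0 < arity;
  ladget_uniq : uniq [:: anchor, output & inputs]
}.

Definition color := 'I_3.

(* The Boolean values 0 and 1 are [false] and [true]. *)
Definition bool_value (k : color) : bool := k != ord0.

Definition proper_coloring (G : sgraph) (c : G -> color) : Prop :=
  forall u v : G, adj u v -> c u <> c v.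

Definition valid_coloring (L : ladget) (c : graph L -> color) : Prop :=
  proper_coloring c /\ c (anchor L) = ord0.

Definition boolfun (n : nat) := {ffun 'I_n -> bool} -> bool.

Definition depends_on_every_input (n : nat) (phi : boolfun n) : Prop :=
  forall i : 'I_n, exists x y : {ffun 'I_n -> bool},
    (forall j : 'I_n, j != i -> x j = y j) /\ phi x <> phi y.

Definition universality (L : ladget) : Prop :=
  forall f : 'I_(arity L) -> color, exists c : graph L -> color,
    valid_coloring c /\ forall i, c (tnth (inputs L) i) = f i.

Definition consistency (L : ladget) (phi : boolfun (arity L)) : Prop :=
  forall c : graph L -> color, valid_coloring c ->
    bool_value (c (output L)) =
    phi [ffun i => bool_value (c (tnth (inputs L) i))].

Definition implements (L : ladget) (phi : boolfun (arity L)) : Prop :=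
  universality L /\ consistency phi.

(* Main.v *)
(** If [a_0] and [theta] were adjacent, [theta] would never get color [0]; by
    universality every Boolean input is realized by a valid coloring, so the
    implemented function would be constantly [1] and depend on no input. *)

Require Import Defs.
From mathcomp Require Import all_boot.

(** Universality prescribes colors, not Boolean values: lift [x] to colors, extend, and let
    consistency read off the output. *)
Lemma implements_surj (L : ladget) (phi : boolfun (arity L))
    (x : {ffun 'I_(arity L) -> bool}) :
  implements phi ->
  exists2 c : graph L -> color, valid_coloring c &
    bool_value (c (output L)) = phi x.
Proof.
case=> univ cons.
(* Color 1 represents the Boolean value 1 here; color 2 would serve equally. *)
have [c [valid_c cE]] := univ (fun i => inord (x i)).
exists c => //; rewrite (cons c valid_c); congr (phi _).
apply/ffunP=> i; rewrite ffunE cE /bool_value -val_eqE /= inordK.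
  by case: (x i).
by case: (x i).
Qed.

Theorem mainTheorem6 (L : ladget) (phi : boolfun (arity L))
    (phi_dep : depends_on_every_input phi) (L_impl : implements phi) :
  ~~ adj (anchor L) (output L).
Proof.
apply/negP=> adj_a0_theta.
have phi_true x : phi x = true.
  have [c [proper_c c_a0] <-] := implements_surj L phi x L_impl.
  (* The view sees through [bool_value]: the goal becomes [c (output L) <> ord0]. *)
  apply/eqP=> c_theta; apply: (proper_c _ _ adj_a0_theta).
  by rewrite c_a0 c_theta.
(* Positive arity supplies an input coordinate, the first one. *)
have [x [y [_ neq_phi]]] := phi_dep (Ordinal (arity_gt0 L)).
by apply: neq_phi; rewrite !phi_true.
Qed.
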